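(* A set $C$ of histories is linearizable with respect to the queue specification if and only if every $c\in C$ has a completion $\hat c\in\mathrm{Compl}(c)$ that has a linearization witness.
   Context: A queue event is a tuple $(u,m,d_{in},d_{out})$ with globally unique identifier $u$, $m\in\{\mathtt{enq},\mathtt{deq}\}$; enqueue events carry a value in $\mathbb{N}$, dequeue events return a value in $\mathbb{N}\cup\{\mathtt{NULL}\}$. Each event $a$ has an invocation action $\mathit{inv}(a)$ (carrying its input) and a response action $\mathit{res}(a)$ (carrying its output). A history is a finite sequence of such actions, each occurring at most once, with each response after its invocation. An event is completed in $c$ if both actions occur, pending if only the invocation occurs; $c$ is complete if nothing is pending. $e\prec_c e'$ iff $\mathit{res}(e)$ occurs before $\mathit{inv}(e')$. A completion of $c$ is a complete history of the form $\hat c$ obtained from $c\cdot c'$, where $c'$ consists only of response actions, by deleting the actions of events still pending; $\mathrm{Compl}(c)$ is the set of completions. A complete sequential history (each invocation immediately followed by its response) is identified with the sequence of its events (a behavior). A behavior $s$ is a linearization of $c$ if there is $\hat c\in\mathrm{Compl}(c)$ whose events are exactly those of $s$ and $e\prec_{\hat c}e'$ implies $e$ before $e'$ in $s$. Legality: $\mathsf{LTS}_Q$ has states finite sequences over $\mathbb{N}$, initial $\varepsilon$, transitions $q\xrightarrow{\mathtt{enq}(x)}q\cdot x$, $x\cdot q'\xrightarrow{\mathtt{deq}(x)}q'$ ($x\in\mathbb{N}$), $\varepsilon\xrightarrow{\mathtt{deq}(\mathtt{NULL})}\varepsilon$; a behavior is legal if it labels a run from $\varepsilon$. A history is linearizable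 w.r.t. the queue if it has a legal linearization; a set of histories is if each member is. For a complete history $c$: $\mathrm{Enq}(c)$, $\mathrm{Deq}(c)$ its enqueue/dequeue events, $\mathrm{Val}(c,e)$ the value enqueued or returned, $\mathrm{Before}(c,e)=\{e'\mid e'\prec_c e\}$. A total map $\mathit{Match}:\mathrm{Deq}(c)\to\mathrm{Enq}(c)\cup\{\bot\}$ is safe if (1) $\mathit{Match}(d)\neq\bot$ implies $\mathrm{Val}(c,d)=\mathrm{Val}(c,\mathit{Match}(d))$; (2) $\mathit{Match}(d)=\bot$ iff $\mathrm{Val}(c,d)=\mathtt{NULL}$; (3) $\mathit{Match}(d)=\mathit{Match}(d')\neq\bot$ implies $d=d'$; it is ordered if also (1) $d\not\prec_c\mathit{Match}(d)$, and (2) whenever $e\prec_c\mathit{Match}(d')$ there is $d$ with $\mathit{Match}(d)=e$ and $d'\not\prec_c d$. For $d_\bot$ with $\mathrm{Val}(c,d_\bot)=\mathtt{NULL}$: $\mathrm{Bad}_0=\{e\in\mathrm{Enq}(c)\mid d_\bot\prec_c e\lor\forall d.\ \mathit{Match}(d)=e\Rightarrow d_\bot\prec_c d\}$, $\mathrm{Bad}_{i+1}=\{e\in\mathrm{Enq}(c)\mid\exists e_i\in\mathrm{Bad}_i.\ e_i\prec_c e\lor\exists d.\ \mathit{Match}(d)=e\wedge e_i\prec_c d\}$, $\mathrm{Bad}(c,d_\bot)=\bigcup_i\mathrm{Bad}_i$. An ordered map is a linearization witness for $c$ if $\mathrm{Bad}(c,d)\cap\mathrm{Before}(c,d)=\emptyset$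 for every $d\in\mathrm{Deq}(c)$ with $\mathrm{Val}(c,d)=\mathtt{NULL}$. *)

(* Defs.v *)
From HB Require Import structures.
From mathcomp Require Import all_boot.

Set Implicit Arguments.
Unset Strict Implicit.
Unset Printing Implicit Defensive.

(** * Events and actions *)

(* The part (m, d_in, d_out) of an event; [None] is the return value NULL. *)
Inductive op := Enq of nat | Deq of option nat.

Inductive input := EnqIn of nat | DeqIn.
Inductive output := EnqOut | DeqOut of option nat.

(* An invocation carries no output, so the return value of a pending dequeue
   is left open; likewise a response carries no input.  An event is thus
   determined by its two actions together, but not by either one alone. *)
Inductive action (U : Type) := Inv of U & input | Res of U & output.

Definition op_code o := match o with Enq x => inl x | Deq r => inr r end.
Definition op_decode o := match o with inl x => Enq x | inr r => Deq r end.
Lemma op_codeK : cancel op_code op_decode. Proof. by case. Qed.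
HB.instance Definition _ := Equality.copy op (can_type op_codeK).

Definition input_code i := if i is EnqIn x then Some x else None.
Definition input_decode o := if o is Some x then EnqIn x else DeqIn.
Lemma input_codeK : cancel input_code input_decode. Proof. by case. Qed.
HB.instance Definition _ := Equality.copy input (can_type input_codeK).

Definition output_code o := if o is DeqOut r then Some r else None.
Definition output_decode o := if o is Some r then DeqOut r else EnqOut.
Lemma output_codeK : cancel output_code output_decode. Proof. by case. Qed.
HB.instance Definition _ := Equality.copy output (can_type output_codeK).

Definition action_code (U : Type) (a : action U) : (U * input) + (U * output) :=
  match a with Inv u i => inl (u, i) | Res u o => inr (u, o) end.
Definition action_decode (U : Type) (a : (U * input) + (U * output)) :=
  match a with inl (u, i) => Inv u i | inr (u, o) => Res u o end.
Lemma action_codeK (U : Type) : cancel (@action_code U) (@action_decode U).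
Proof. by case. Qed.
HB.instance Definition _ (U : eqType) :=
  Equality.copy (action U) (can_type (@action_codeK U)).

Definition event (U : Type) : Type := U * op.

Section Queue.

Variable U : eqType.
Implicit Types (c : seq (action U)) (a b : action U) (s : seq (event U)).
Implicit Types (e d : event U) (M : event U -> option (event U)) (u : U).

Definition inv e : action U :=
  Inv e.1 (match e.2 with Enq x => EnqIn x | Deq _ => DeqIn end).
Definition res e : action U :=
  Res e.1 (match e.2 with Enq _ => EnqOut | Deq r => DeqOut r end).

Definition action_id a : U := match a with Inv u _ | Res u _ => u end.
Definition is_inv a : bool := if a is Inv _ _ then true else false.
Definition is_res a : bool := ~~ is_inv a.
Definition is_enq e : bool := if e.2 is Enq _ then true else false.
Definition is_deq e : bool := ~~ is_enq e.

Definition Val e : option nat :=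
  match e.2 with Enq x => Some x | Deq r => r end.

(** * Histories *)

Definition occurs_before c a b : bool :=
  [&& a \in c, b \in c & index a c < index b c].

(* The second clause is the uniqueness of event identifiers: a history has at
   most one invocation and at most one response with a given identifier. *)
Definition is_history c : Prop :=
  [/\ uniq c,
      {in c &, forall a b,
         action_id a = action_id b -> is_inv a = is_inv b -> a = b}
    & {in c, forall a, is_res a ->
         exists2 e, res e = a & occurs_before c (inv e) (res e)}].

Definition pending c u : bool :=
  has (fun a => (action_id a == u) && is_inv a) c &&
  ~~ has (fun a => (action_id a == u) && is_res a) c.

Definition completed c : pred (event U) :=
  [pred e | (inv e \in c) && (res e \in c)].

Definition complete_history c : Prop :=
  is_history c /\ forall u, ~~ pending c u.

(* Since [res e] omits the input and [inv e'] omits the output, this is only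
   meaningful for events e, e' of c, and it is always used so restricted. *)
Definition precedes c e e' : bool := occurs_before c (res e) (inv e').

Definition delete_pending c : seq (action U) :=
  [seq a <- c | ~~ pending c (action_id a)].

Definition Compl c chat : Prop :=
  complete_history chat /\
  exists2 c', all is_res c' & chat = delete_pending (c ++ c').

(** * Behaviors, linearizations and the queue specification *)

Definition sequential_history s : seq (action U) :=
  flatten [seq [:: inv e; res e] | e <- s].

Definition behavior s : Prop := is_history (sequential_history s).

Definition linearization c s : Prop :=
  behavior s /\
  exists chat,
    [/\ Compl c chat,
        s =i completed chat
      & {in completed chat &, forall e e',
           precedes chat e e' -> index e s < index e' s}].

Inductive lts_queue : seq nat -> op -> seq nat -> Prop :=
| lts_enq q x : lts_queue q (Enq x) (rcons q x)
| lts_deq x q : lts_queue (x :: q) (Deq (Some x)) q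
| lts_deq_null : lts_queue [::] (Deq None) [::].

Inductive lts_run : seq nat -> seq op -> seq nat -> Prop :=
| run_nil q : lts_run q [::] q
| run_cons q o q' w q'' :
    lts_queue q o q' -> lts_run q' w q'' -> lts_run q (o :: w) q''.

Definition legal s : Prop := exists q, lts_run [::] [seq e.2 | e <- s] q.

Definition linearizable c : Prop := exists2 s, linearization c s & legal s.

Definition set_linearizable (C : seq (action U) -> Prop) : Prop :=
  forall c, C c -> linearizable c.

(** * Linearization witnesses, for a complete history c *)

Definition EnqEv c : pred (event U) := [pred e | completed c e & is_enq e].
Definition DeqEv c : pred (event U) := [pred d | completed c d & is_deq d].
Definition Before c e : pred (event U) :=
  [pred e' | completed c e' & precedes c e' e].

(* A map Deq(c) -> Enq(c) + {bottom}: bottom is [None], and the values of M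
   outside Deq(c) are irrelevant, as every use of M below is at a dequeue
   event of c. *)
Definition match_map c M : Prop :=
  {in DeqEv c, forall d e, M d = Some e -> e \in EnqEv c}.

Definition safe c M : Prop :=
  [/\ match_map c M,
      {in DeqEv c, forall d e, M d = Some e -> Val d = Val e},
      {in DeqEv c, forall d, M d = None <-> Val d = None}
    & {in DeqEv c &, forall d d', M d = M d' -> M d <> None -> d = d'}].

Definition ordered c M : Prop :=
  [/\ safe c M,
      {in DeqEv c, forall d e, M d = Some e -> ~~ precedes c d e}
    & forall d' e' e, d' \in DeqEv c -> e \in EnqEv c ->
        M d' = Some e' -> precedes c e e' ->
        exists d, [/\ d \in DeqEv c, M d = Some e & ~~ precedes c d' d]].

Fixpoint Bad_ c M (dnull : event U) (i : nat) (e : event U) : Prop :=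
  e \in EnqEv c /\
  match i with
  | 0 => precedes c dnull e \/
         (forall d, d \in DeqEv c -> M d = Some e -> precedes c dnull d)
  | j.+1 => exists ej, Bad_ c M dnull j ej /\
         (precedes c ej e \/
          exists d, [/\ d \in DeqEv c, M d = Some e & precedes c ej d])
  end.

Definition Bad c M (dnull e : event U) : Prop := exists i, Bad_ c M dnull i e.

Definition linearization_witness c M : Prop :=
  ordered c M /\
  {in DeqEv c, forall d, Val d = None ->
     forall e, ~ (Bad c M d e /\ e \in Before c d)}.

End Queue.

(* Main.v *)
(** From a legal linearization, match the k-th non-NULL dequeue with the k-th
    enqueue.

    Conversely, given a witness, an event e of the complete history c is an
    interval [I e, R e] of positions in c.  Pair an enqueue e with the dequeue d
    that it is matched with, and attach to the pair an enqueue window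
    [I e, min (R e) (R d)] and a dequeue window [max (I e) (I d), R d].  The
    conditions on bad sets provide for every NULL dequeue a cut point tau in its
    interval, and both its windows are shrunk to [tau, tau].  Orderedness and
    the cut property say that the two interval orders formed by the enqueue
    and by the dequeue windows never contradict each other on two nodes, which
    for interval orders is enough to have a common linear extension.
    The running maxima of the left ends along that extension lie in
    the windows; they are the linearization points, ties being resolved by the
    extension. *)

From mathcomp Require Import all_boot zify.
Require Import Defs.

Set Implicit Arguments.
Unset Strict Implicit.
Unset Printing Implicit Defensive.

(** * Common linear extensions of two interval orders *)

Lemma argmin_seq (T : eqType) (f : T -> nat) (s : seq T) : s != [::] ->
  exists2 x, x \in s & {in s, forall y, f x <= f y}.
Proof.
elim: s => [//|a [|b s] IHs] _.
  exists a; first exact: mem_head.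
  by move=> y; rewrite inE => /eqP->.
have [x xs xP] := IHs isT.
have [le_ax|lt_xa] := leqP (f a) (f x).
  exists a; first exact: mem_head.
  move=> y; rewrite inE => /predU1P[->//|/xP].
  exact: leq_trans.
exists x; first by rewrite inE xs orbT.
by move=> y; rewrite inE => /predU1P[->|/xP//]; apply: ltnW.
Qed.

(* Two interval orders, [r1 p < i1 q] and [r2 p < i2 q], have a common linear
   extension as soon as they never contradict each other on a single pair:
   then a node with the least [r1] or one with the least [r2] is minimal for
   both orders. *)
Lemma interval_orders_sort (T : eqType) (i1 r1 i2 r2 : T -> nat) (s : seq T) :
    {in s, forall x, i1 x <= r1 x} -> {in s, forall x, i2 x <= r2 x} ->
    {in s &, forall x y, r1 x < i1 y -> r2 y < i2 x -> False} ->
  exists2 l, perm_eq l s &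
    pairwise (fun x y => (i1 x <= r1 y) && (i2 x <= r2 y)) l.
Proof.
move: {2}(size s) (erefl (size s)) => n; elim: n s => [|n IHn] s sz le1 le2 no2.
  by exists [::]; rewrite // (size0nil sz).
have s_nz : s != [::] by rewrite -size_eq0 sz.
have [p ps pP] : exists2 p, p \in s &
    {in s, forall y, (i1 p <= r1 y) && (i2 p <= r2 y)}.
  have [a a_s aP] := argmin_seq r1 s_nz; have [b b_s bP] := argmin_seq r2 s_nz.
  (* [a] is minimal for the first order and [b] for the second. If each fails in the other order,
     [r2 b < i2 a] and [r1 a < i1 b], the contradiction excluded by [no2]. *)
  have [le_a|lt_a] := leqP (i2 a) (r2 b).
    exists a => // y ys; rewrite (leq_trans le_a (bP _ ys)).
    by rewrite (leq_trans (le1 _ a_s) (aP _ ys)).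
  have [le_b|lt_b] := leqP (i1 b) (r1 a); last by case: (no2 a b).
  exists b => // y ys; rewrite (leq_trans le_b (aP _ ys)).
  by rewrite (leq_trans (le2 _ b_s) (bP _ ys)).
have sub : {subset rem p s <= s} by apply: mem_rem.
have [||||l l_perm l_pw] := IHn (rem p s).
- by rewrite size_rem // sz.
- by move=> x /sub; apply: le1.
- by move=> x /sub; apply: le2.
- by move=> x y /sub xs /sub ys; apply: no2.
exists (p :: l) => /=.
  by rewrite perm_sym (perm_trans (perm_to_rem ps)) // perm_cons perm_sym.
rewrite l_pw andbT; apply/allP => y; rewrite (perm_mem l_perm) => /sub.
exact: pP.
Qed.

(** A running maximum is attained at some [y] ranked no later than [x], and the common extension
    gives [i1 y <= r1 x] and [i2 y <= r2 x], so it stays in the window of [x]. The rank is returned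
    as well, since points may coincide and ties have to be broken in the same way for both
    families. *)
Lemma interval_orders_points (T : eqType) (i1 r1 i2 r2 : T -> nat) (s : seq T) :
    {in s, forall x, i1 x <= r1 x} -> {in s, forall x, i2 x <= r2 x} ->
    {in s, forall x, i1 x <= i2 x} ->
    {in s &, forall x y, r1 x < i1 y -> r2 y < i2 x -> False} ->
  exists rank t1 t2 : T -> nat,
    [/\ {in s &, injective rank} /\ {in s, forall x, rank x < size s},
        {in s, forall x, i1 x <= t1 x <= r1 x},
        {in s, forall x, i2 x <= t2 x <= r2 x},
        {in s, forall x, t1 x <= t2 x}
      & {in s &, forall x y, rank x <= rank y -> t1 x <= t1 y /\ t2 x <= t2 y}].
Proof.
move=> le1 le2 le12 no2.
have [l l_perm l_pw] := interval_orders_sort le1 le2 no2.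
have l_s := perm_mem l_perm.
pose rank x := index x l.
pose t (f : T -> nat) x := \max_(y <- l | rank y <= rank x) f y.
have tP (f : T -> nat) x y : y \in s -> rank y <= rank x -> f y <= t f x.
  by rewrite -l_s; apply: leq_bigmax_seq.
have tL (f : T -> nat) x m :
    {in l, forall y, rank y <= rank x -> f y <= m} -> t f x <= m.
  by move=> H; apply/bigmax_leqP_seq => y yl; apply: H.
have rank_inj : {in s &, injective rank}.
  by move=> x y; rewrite -!l_s => xl yl; apply: index_inj.
have rankP : {in s &, forall x y, rank x <= rank y ->
    (i1 x <= r1 y) && (i2 x <= r2 y)}.
  move=> x y xs ys; rewrite leq_eqVlt => /predU1P[/rank_inj->//|lt_xy].
    by rewrite le1 // le2.
  have yl : y \in l by rewrite l_s.
  move/(pairwiseP x): l_pw => /(_ (rank x) (rank y)).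
  rewrite !inE !index_mem !l_s !nth_index ?l_s //; exact.
exists rank, (t i1), (t i2); split=> [|x xs|x xs|x xs|x y xs ys le_xy].
- by split=> // x xs; rewrite -(perm_size l_perm) index_mem l_s.
- rewrite tP //=; apply: tL => y yl le_yx.
  by rewrite l_s in yl; case/andP: (rankP _ _ yl xs le_yx).
- rewrite tP //=; apply: tL => y yl le_yx.
  by rewrite l_s in yl; case/andP: (rankP _ _ yl xs le_yx).
- apply: tL => y yl le_yx; rewrite l_s in yl.
  by apply: leq_trans (le12 _ yl) (tP _ _ _ yl le_yx).
- by split; apply: tL => z; rewrite l_s => zs le_zx; apply: tP;
    rewrite ?(leq_trans le_zx).
Qed.

(** * Finite choice and positions in sequences *)

Lemma choice_seq (T : eqType) (s : seq T) (P : T -> nat -> Prop) :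
  {in s, forall x, exists n, P x n} ->
  exists f : T -> nat, {in s, forall x, P x (f x)}.
Proof.
elim: s => [|a s IHs] H; first by exists (fun=> 0).
have [x xs|f fP] := IHs; first by apply: H; rewrite inE xs orbT.
have [n nP] := H a (mem_head _ _).
exists (fun x => if x == a then n else f x) => x; rewrite inE.
by case: eqP => [->|_ /fP].
Qed.

Lemma index_filter_lt (T : eqType) (p : pred T) (s : seq T) x y :
    p x -> p y -> x \in s -> y \in s ->
  (index x (filter p s) < index y (filter p s)) = (index x s < index y s).
Proof.
move=> px py; elim: s => [//|a s IHs]; rewrite !inE /=.
have [->|ax] := eqVneq a x; first by rewrite px /= eqxx; case: eqVneq.
have [->|ay] := eqVneq a y; first by rewrite py /= eqxx; case: eqVneq.
move=> /= xs ys.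
by case: (p a); rewrite /= ?(negbTE ax) ?(negbTE ay) ?ltnS; apply: IHs.
Qed.

Lemma index_lt_cat (T : eqType) (s1 s2 : seq T) x y :
    x \notin s1 ->
  (index y (s1 ++ x :: s2) < index x (s1 ++ x :: s2)) = (y \in s1).
Proof.
move=> xs1; rewrite !index_cat (negbTE xs1) /= eqxx addn0.
case: ifPn => ys1; first by rewrite index_mem.
by rewrite ltnNge leq_addr.
Qed.

Lemma index_sort_key (T : eqType) (key : T -> nat) (s : seq T) :
  let s' := sort (fun x y => key x <= key y) s in
  {in s &, forall x y, index x s' < index y s' -> key x <= key y}.
Proof.
move=> s' x y xs ys.
apply: (sorted_ltn_index (leT := fun x y => key x <= key y)); rewrite ?mem_sort //.
  by move=> a b d; apply: leq_trans.
by apply: sort_sorted => a b; apply: leq_total.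
Qed.

Lemma index_sort_key_lt (T : eqType) (key : T -> nat) (s : seq T) :
  let s' := sort (fun x y => key x <= key y) s in
  {in s &, forall x y, key x < key y -> index x s' < index y s'}.
Proof.
move=> s' x y xs ys; rewrite ltnNge; apply: contraNltn.
rewrite leq_eqVlt => /predU1P[/(index_inj x)|/index_sort_key]; last exact.
by rewrite !mem_sort => ->.
Qed.

(** The triple [(t, r, b)] as a mixed-radix number: as long as [r < n], sorting by it is
    lexicographic sorting. *)
Definition lex_key (n t r : nat) (b : bool) : nat := (t * n + r).*2 + b.

Lemma lex_key_lt1 n t r b t' r' b' :
  r < n -> t < t' -> lex_key n t r b < lex_key n t' r' b'.
Proof.
rewrite /lex_key => lt_r lt_t.
have : t.+1 * n <= t' * n by rewrite leq_mul2r lt_t orbT.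
by rewrite mulSn; case: b; case: b'; lia.
Qed.

Lemma lex_key_lt2 n t r b t' r' b' :
  t <= t' -> r < r' -> lex_key n t r b < lex_key n t' r' b'.
Proof.
rewrite /lex_key => le_t lt_r.
have : t * n <= t' * n by rewrite leq_mul2r le_t orbT.
by case: b; case: b'; lia.
Qed.

Lemma lex_key_lt3 n t r t' :
  t <= t' -> lex_key n t r false < lex_key n t' r true.
Proof.
rewrite /lex_key => le_t.
have : t * n <= t' * n by rewrite leq_mul2r le_t orbT.
by lia.
Qed.

Section Queue.

Variable U : eqType.
Implicit Types (c : seq (action U)) (s : seq (event U)) (e d x y : event U).
Implicit Types (M : event U -> option (event U)).

(** * Legality as the existence of a FIFO matching *)

(** The sequential counterpart of a witness: positions in [s] replace [precedes], and the last
    clause, by which the queue is empty at a NULL dequeue, replaces the condition on bad sets. *)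
Definition fifo_matching s M : Prop :=
  [/\ forall d e, d \in s -> is_deq d -> M d = Some e ->
        [/\ e \in s, is_enq e, Val d = Val e & index e s < index d s],
      forall d, d \in s -> is_deq d -> M d = None <-> Val d = None,
      forall d d', d \in s -> d' \in s -> is_deq d -> is_deq d' ->
        M d = M d' -> M d <> None -> d = d',
      forall d' e' e, d' \in s -> is_deq d' -> M d' = Some e' ->
        e \in s -> is_enq e -> index e s < index e' s ->
        exists d, [/\ d \in s, is_deq d, M d = Some e & index d s < index d' s]
    & forall d e, d \in s -> is_deq d -> Val d = None ->
        e \in s -> is_enq e -> index e s < index d s ->
        exists d', [/\ d' \in s, is_deq d', M d' = Some e
                     & index d' s < index d s]].

Lemma lts_run_cat q w1 w2 q'' :
  lts_run q (w1 ++ w2) q'' <->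
  exists2 q', lts_run q w1 q' & lts_run q' w2 q''.
Proof.
split.
  elim: w1 q => [|o w1 IHw] q /=; first by exists q; first exact: run_nil.
  move=> H; inversion H as [|q0 o0 q1 w q2 qo run]; subst.
  have [q' run1 run2] := IHw _ run.
  by exists q' => //; apply: run_cons qo run1.
case=> q'; elim => // q0 o q1 w q2 qo _ IH /IH.
exact: run_cons.
Qed.

Lemma lts_run1 q o q' : lts_run q [:: o] q' <-> lts_queue q o q'.
Proof.
split=> [H|qo]; last by apply: run_cons qo (run_nil _).
inversion H as [|q0 o0 q1 w q2 qo run]; subst.
by inversion run; subst.
Qed.

Definition is_value_deq d : bool := is_deq d && (Val d != None).

(** The FIFO invariant: an enqueue extends both sides at the end, and a dequeue moves the head of
    the queue across the [++]. *)
Lemma lts_run_values s q : lts_run [::] [seq e.2 | e <- s] q ->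
  [seq Val e | e <- s & is_enq e] =
  [seq Val d | d <- s & is_value_deq d] ++ [seq Some n | n <- q].
Proof.
elim/last_ind: s q => [|s [u o] IHs] q /=; first by inversion 1.
rewrite map_rcons -cats1 => /lts_run_cat[q' /IHs eq_s /lts_run1 /= qo].
rewrite !filter_rcons /is_value_deq /is_deq /is_enq /Val /=.
case: o qo => [x|[x|]] qo; inversion qo; subst => /=.
- by rewrite map_rcons eq_s map_rcons rcons_cat.
- by rewrite eq_s map_rcons /= cat_rcons.
- by rewrite eq_s.
Qed.

Lemma legal_fifo_matching s : uniq s -> legal s -> exists M, fifo_matching s M.
Proof.
move=> s_uniq [q s_run].
set E := [seq e <- s | is_enq e]; set D := [seq d <- s | is_value_deq d].
have E_uniq : uniq E by apply: filter_uniq.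
have D_uniq : uniq D by apply: filter_uniq.
(* The default [d] of [nth] is never reached for [d] in [s]: [DP] shows that the index is below
   [size E]. *)
pose M d := if is_value_deq d then Some (nth d E (index d D)) else None.
(* Cutting the run just before [d] gives the queue content [q'] that [d] meets, and the invariant
   for the prefix [s1]. *)
have split_s d : d \in s -> exists s1 s2 q' q'',
    [/\ s = s1 ++ d :: s2, d \notin s1, lts_queue q' d.2 q''
      & [seq Val e | e <- s1 & is_enq e] =
        [seq Val d | d <- s1 & is_value_deq d] ++ [seq Some n | n <- q']].
  move=> ds; move: s_run s_uniq; case/splitPr: ds => s1 s2.
  rewrite map_cat => /lts_run_cat[q' run1 run2].
  rewrite cat_uniq /= negb_or => /and3P[_ /andP[ds1 _] _].
  inversion run2 as [|q0 o0 q1 w q2 qo run]; subst.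
  by exists s1, s2, q', q1; split=> //; apply: lts_run_values.
(* A dequeue of a value meets a nonempty queue, so [s1] has more enqueues than value dequeues; the
   enqueue with the index of [d] thus lies in [s1], and its value is the head of the queue. *)
have DP d : d \in s -> is_value_deq d ->
    [/\ index d D < size E, Val d = Val (nth d E (index d D))
      & index (nth d E (index d D)) s < index d s].
  move=> ds dv; have [s1 [s2 [q' [q'' [s_eq ds1 qo eqv]]]]] := split_s d ds.
  have idx : index d D = size [seq d <- s1 | is_value_deq d].
    rewrite /D s_eq filter_cat /= dv index_cat mem_filter (negbTE ds1) andbF.
    by rewrite /= eqxx addn0.
  have [n [q0 [eq_q eq_d]]] : exists n q0, q' = n :: q0 /\ Val d = Some n.
    move: dv qo; rewrite /is_value_deq /is_deq /is_enq /Val.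
    by case: (d.2) => [//|[n|//]] _ qo; inversion qo; subst; exists n, q''.
  have sz := congr1 size eqv; rewrite size_cat !size_map eq_q /= in sz.
  have lt_idx : index d D < size [seq e <- s1 | is_enq e] by rewrite sz idx; lia.
  have nthE : nth d E (index d D) = nth d [seq e <- s1 | is_enq e] (index d D).
    by rewrite /E s_eq filter_cat nth_cat lt_idx.
  split.
  - by rewrite /E s_eq filter_cat size_cat; lia.
  - have := congr1 (fun l => nth None l (index d D)) eqv.
    rewrite (nth_map d) // -nthE => ->.
    by rewrite nth_cat size_map -idx ltnn subnn eq_q.
  - rewrite s_eq index_lt_cat // nthE.
    by have := mem_nth d lt_idx; rewrite mem_filter => /andP[].
exists M; split.
- move=> d e ds _; rewrite /M; case: ifP => // dv [<-].
  have [lt_E eq_v lt_i] := DP d ds dv.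
  by have := mem_nth d lt_E; rewrite mem_filter => /andP[].
- move=> d ds dd; rewrite /M /is_value_deq dd.
  by split; [case: eqP | move=> ->].
- move=> d d' ds d's _ _; rewrite /M.
  case: ifP => // dv; case: ifP => // d'v [eq_e] _.
  have [lt_E _ _] := DP d ds dv; have [lt_E' _ _] := DP d' d's d'v.
  move/eqP: eq_e; rewrite (set_nth_default d) // nth_uniq // => /eqP.
  by apply: (index_inj d); rewrite mem_filter ?dv ?d'v.
- move=> d' e' e d's d'd; rewrite /M; case: ifP => // d'v [eq_e'] es ee lt_ee'.
  have [lt_E _ _] := DP d' d's d'v.
  have e'E : e' \in E by rewrite -eq_e' mem_nth.
  have /[!mem_filter]/andP[ee' e's] := e'E.
  have lt_i : index e E < index d' D.
    by rewrite -(@index_uniq _ d' (index d' D) E) // eq_e' index_filter_lt.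
  have d'D : d' \in D by rewrite mem_filter d'v.
  have lt_D : index e E < size D.
    by apply: ltn_trans lt_i _; rewrite index_mem.
  set d := nth d' D (index e E).
  have dD : d \in D by apply: mem_nth.
  have /[!mem_filter]/andP[dv ds] := dD.
  exists d; split=> //; first by case/andP: dv.
    by rewrite dv index_uniq // nth_index // mem_filter ee.
  by rewrite -(@index_filter_lt _ is_value_deq) // index_uniq.
(* A NULL dequeue meets an empty queue, so [s1] has as many value dequeues as enqueues, and the one
   with the index of [e] serves [e]. *)
- move=> d e ds dd d0 es ee lt_ed.
  have [s1 [s2 [q' [q'' [s_eq ds1 qo eqv]]]]] := split_s d ds.
  have eq_q : q' = [::].
    move: dd d0 qo; rewrite /is_deq /is_enq /Val.
    by case: (d.2) => [|[]] // _ _ qo; inversion qo.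
  have sz := congr1 size eqv; rewrite size_cat !size_map eq_q addn0 in sz.
  have es1 : e \in s1 by move: lt_ed; rewrite s_eq index_lt_cat.
  have eE1 : e \in [seq e <- s1 | is_enq e] by rewrite mem_filter ee.
  set k := index e [seq e <- s1 | is_enq e].
  have ltk : k < size [seq d <- s1 | is_value_deq d] by rewrite -sz index_mem.
  have eq_k : index e E = k by rewrite /E s_eq filter_cat index_cat eE1.
  set d' := nth d [seq d <- s1 | is_value_deq d] k.
  have := mem_nth d ltk; rewrite -/d' mem_filter => /andP[d'v d's1].
  have d's : d' \in s by rewrite s_eq mem_cat d's1.
  exists d'; split=> //; first by case/andP: d'v.
    rewrite /M d'v; congr Some.
    have -> : index d' D = k.
      rewrite /D s_eq filter_cat index_cat mem_filter d'v d's1 /=.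
      rewrite index_uniq //; move: s_uniq; rewrite s_eq cat_uniq => /and3P[H _ _].
      exact: filter_uniq.
    by rewrite -eq_k nth_index // mem_filter ee.
  by rewrite s_eq index_lt_cat.
Qed.

Lemma fifo_matching_legal s M : uniq s -> fifo_matching s M -> legal s.
Proof.
move=> s_uniq [MA MB MC MD ME].
pose unmatched s1 e := is_enq e && ~~ has (fun d => is_deq d && (M d == Some e)) s1.
(* The state reached after a prefix: the values of the enqueues not yet served in it, oldest first.
   The run is built one event at a time. *)
pose queue s1 := pmap (@Val U) [seq e <- s1 | unmatched s1 e].
suff run s1 s2 : s = s1 ++ s2 -> lts_run [::] [seq e.2 | e <- s1] (queue s1).
  by exists (queue s); apply: (run s [::]); rewrite cats0.
elim/last_ind: s1 s2 => [|s1 x IHs] s2; first by move=> _; apply: run_nil.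
rewrite cat_rcons => s_eq.
have xs1 : x \notin s1.
  by move: s_uniq; rewrite s_eq cat_uniq /= negb_or => /and3P[_ /andP[]].
have s1_uniq : uniq s1 by move: s_uniq; rewrite s_eq cat_uniq => /and3P[].
have before y : (index y s < index x s) = (y \in s1).
  by rewrite s_eq index_lt_cat.
have xs : x \in s by rewrite s_eq mem_cat mem_head orbT.
have s1s y : y \in s1 -> y \in s by rewrite s_eq mem_cat => ->.
rewrite map_rcons -cats1; apply/lts_run_cat.
exists (queue s1); first exact: IHs s_eq.
apply/lts_run1.
have [xe|xd] := boolP (is_enq x).
  have -> : queue (rcons s1 x) = rcons (queue s1) (odflt 0 (Val x)).
    rewrite /queue filter_rcons.
    have /eq_in_filter-> : {in s1, unmatched (rcons s1 x) =1 unmatched s1}.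
      by move=> e _; rewrite /unmatched has_rcons /is_deq xe.
    (* A fresh enqueue cannot have been served in [s1], because every dequeue comes after its
       enqueue. *)
    have -> : unmatched (rcons s1 x) x.
      rewrite /unmatched xe has_rcons /is_deq xe /=; apply/hasPn => d ds1.
      apply/negP => /andP[dd /eqP Md].
      have [_ _ _ lt_xd] := MA _ _ (s1s _ ds1) dd Md.
      by move: ds1; rewrite -before ltnNge (ltnW lt_xd).
    rewrite -cats1 pmap_cat -cats1 /= /Val.
    by move: xe; rewrite /is_enq; case: (x.2).
  move: xe; rewrite /is_enq /Val; case: (x.2) => // v _; exact: lts_enq.
case Mx: (M x) => [e|]; last first.
  have Vx := (MB _ xs xd).1 Mx.
  have q0 : [seq e <- s1 | unmatched s1 e] = [::].
    apply/eqP; rewrite -[_ == _]negbK -has_filter; apply/hasPn => e es1.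
    apply/negP => /andP[ee /hasP[]].
    have [|d [ds dd Md lt_dx]] := ME _ _ xs xd Vx (s1s _ es1) ee.
      by rewrite before.
    by exists d; rewrite -?before // dd Md eqxx.
  have -> : queue (rcons s1 x) = [::].
    rewrite /queue filter_rcons.
    have -> : unmatched (rcons s1 x) x = false by rewrite /unmatched (negbTE xd).
    rewrite (_ : filter _ _ = [::]) //.
    rewrite -[RHS]q0; apply: eq_in_filter => y _.
    by rewrite /unmatched has_rcons Mx andbF.
  rewrite /queue q0 /=; move: xd Vx; rewrite /is_deq /is_enq /Val.
  by case: (x.2) => // r _ ->; apply: lts_deq_null.
have [es ee Vxe lt_ex] := MA _ _ xs xd Mx.
have es1 : e \in s1 by rewrite -before.
have ue : unmatched s1 e.
  rewrite /unmatched ee; apply/hasPn => d ds1; apply/negP => /andP[dd /eqP Md].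
  have dx : d = x by apply: MC; rewrite ?Md ?Mx //; apply: s1s.
  by rewrite -dx ds1 in xs1.
have ux : unmatched (rcons s1 x) x = false by rewrite /unmatched (negbTE xd).
(* The enqueue served by [x] heads the queue: by the fourth clause all older enqueues have been
   served before [x]. *)
have eqf : [seq y <- s1 | unmatched s1 y] =
    e :: [seq y <- s1 | unmatched (rcons s1 x) y].
  have earlier y : index y s < index e s -> y \in s1 -> ~~ unmatched s1 y.
    move=> lt_ye ys1; apply/negP => /andP[ye /hasP[]].
    have [d [ds dd Md lt_dx]] := MD _ _ _ xs xd Mx (s1s _ ys1) ye lt_ye.
    by exists d; rewrite -?before // dd Md eqxx.
  have ue' y : unmatched (rcons s1 x) y = (y != e) && unmatched s1 y.
    rewrite /unmatched has_rcons /is_deq xd Mx /= negb_or andbCA; congr (_ && _).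
    by rewrite [in RHS]eq_sym.
  move: es1 s_eq s1_uniq earlier; set u := unmatched s1 in ue ue' *.
  set u' := unmatched (rcons s1 x) in ue' *.
  case/splitPr => l1 l2; rewrite -catA /= => s_eq.
  rewrite cat_uniq /= negb_or => /and3P[_ /andP[el1 _] /andP[el2 _]] earlier.
  rewrite !filter_cat /= ue' eqxx /= ue.
  have l1u : {in l1, forall y, ~~ u y}.
    move=> y yl1; apply: earlier; last by rewrite mem_cat yl1.
    by rewrite s_eq index_lt_cat.
  have -> : [seq y <- l1 | u y] = [::].
    by apply/eqP; rewrite -[_ == _]negbK -has_filter; apply/hasPn.
  have -> : [seq y <- l1 | u' y] = [::].
    apply/eqP; rewrite -[_ == _]negbK -has_filter; apply/hasPn => y yl1.
    by rewrite ue' negb_and l1u ?orbT.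
  congr (_ :: _); apply: eq_in_filter => y yl2; rewrite ue'.
  by have [eq_ye|//] := eqVneq; rewrite -eq_ye yl2 in el2.
have [v Ve] : exists v, Val e = Some v.
  by move: ee; rewrite /is_enq /Val; case: (e.2) => // v _; exists v.
rewrite /queue filter_rcons ux eqf /= Ve.
move: xd Vxe; rewrite Ve /is_deq /is_enq /Val.
by case: (x.2) => // r _ ->; apply: lts_deq.
Qed.

(** * Sequential histories *)

Lemma sequential_history_cons e s :
  sequential_history (e :: s) = inv e :: res e :: sequential_history s.
Proof. by []. Qed.

Lemma mem_sequential_history s a :
  a \in sequential_history s -> exists2 e, e \in s & a = inv e \/ a = res e.
Proof.
case/flatten_mapP => e es; rewrite !inE => /orP[]/eqP->; exists e => //; by [left|right].
Qed.

Lemma inv_sequential_history s e : e \in s -> inv e \in sequential_history s.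
Proof. by move=> es; apply/flatten_mapP; exists e; rewrite ?inE ?eqxx. Qed.

Lemma behavior_uniq s : behavior s -> uniq s.
Proof.
case=> + _ _; elim: s => [//|e s IHs].
rewrite sequential_history_cons /= inE negb_or.
case/and3P => /andP[_ es] _ /IHs->; rewrite andbT.
by apply: contra es; apply: inv_sequential_history.
Qed.

Lemma behavior_uniq_id s : uniq [seq e.1 | e <- s] -> behavior s.
Proof.
move=> ids_uniq.
have id_inj : {in s &, forall e e', e.1 = e'.1 -> e = e'}.
  elim: s ids_uniq => [//|a s IHs] /= /andP[a_s /IHs{}IHs] e e'.
  rewrite !inE => /predU1P[->|es] /predU1P[->|e's] eq_id //.
  - by case/negP: a_s; rewrite eq_id map_f.
  - by case/negP: a_s; rewrite -eq_id map_f.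
  - exact: IHs.
have sh_uniq : uniq (sequential_history s).
  elim: s ids_uniq {id_inj} => [//|e s IHs].
  rewrite map_cons cons_uniq sequential_history_cons !cons_uniq.
  case/andP => es /IHs->; rewrite andbT inE negb_or /=.
  by apply/andP; split; apply: contra es => /mem_sequential_history[e' e's];
    case=> /(congr1 (@action_id U)) /= ->; rewrite map_f.
split=> //.
  move=> a b /mem_sequential_history[e es [->|->]];
    move=> /mem_sequential_history[e' e's [->|->]] //= eq_id _;
    by rewrite (id_inj e e').
move=> a /mem_sequential_history[e es [->|->]] // _; exists e => //.
elim: s es sh_uniq {ids_uniq id_inj} => [//|e' s IHs].
rewrite /occurs_before sequential_history_cons inE => /predU1P[->|es] /=.
  by rewrite !inE !eqxx orbT.
rewrite !inE !negb_or => /and3P[/andP[_ i_ne] r_ne /(IHs es)].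
case/and3P => i_in r_in lt_i; rewrite i_in r_in !orbT /=.
have -> : inv e' == inv e = false.
  by apply/negP => /eqP eq_i; rewrite eq_i i_in in i_ne.
have -> : res e' == res e = false.
  by apply/negP => /eqP eq_r; rewrite eq_r r_in in r_ne.
by rewrite /= !ltnS.
Qed.

(** * Completed events of a history *)

Lemma inv_res_inj e e' : inv e = inv e' -> res e = res e' -> e = e'.
Proof.
by case: e e' => [u [n|r]] [u' [n'|r']]; rewrite /inv /res /=; congruence.
Qed.

(** A partial left inverse of [e |-> (inv e, res e)]. Two actions with different identifiers may
    also decode to an event, hence the filter by [completed] in [completed_enum]. *)
Definition event_of (ab : action U * action U) : option (event U) :=
  match ab with
  | (Inv u (EnqIn x), Res _ EnqOut) => Some (u, Enq x)
  | (Inv u DeqIn, Res _ (DeqOut r)) => Some (u, Deq r)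
  | _ => None
  end.

Lemma completed_enum c : exists2 s, uniq s & s =i completed c.
Proof.
exists (undup [seq e <- pmap event_of [seq (a, b) | a <- c, b <- c]
                 | completed c e]); first exact: undup_uniq.
move=> e; rewrite mem_undup mem_filter; apply: andb_idr => /andP[ic rc].
rewrite mem_pmap; apply/mapP; exists (inv e, res e).
  by apply/allpairsP; exists (inv e, res e).
by case: e {ic rc} => u [x|r].
Qed.

Section CompleteHistory.

Variable c : seq (action U).
Hypothesis c_hist : is_history c.

Let I e := index (inv e) c.
Let R e := index (res e) c.

Lemma precedes_index e e' : completed c e -> completed c e' ->
  precedes c e e' = (index (res e) c < index (inv e') c).
Proof. by case/andP=> _ re /andP[ie _]; rewrite /precedes /occurs_before re ie. Qed.

Lemma completed_id_inj e e' : completed c e -> completed c e' ->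
  e.1 = e'.1 -> e = e'.
Proof.
case: c_hist => _ id_inj _ /andP[ie re] /andP[ie' re'] eq_id.
by apply: inv_res_inj; apply: id_inj.
Qed.

(** [is_history] puts before [res e] only the invocation of some event with the same response;
    uniqueness of identifiers makes it [inv e]. *)
Lemma completed_index e : completed c e -> index (inv e) c < index (res e) c.
Proof.
case: c_hist => _ id_inj resP /andP[ie re].
have [e' eq_r /and3P[ie' _]] := resP _ re isT.
rewrite eq_r; have -> // : inv e' = inv e.
by apply: id_inj => //; case: eq_r.
Qed.

(** * From a linearization to a witness *)

(** Since [precedes c] is contained in the order of [s], the ordering clauses carry over. For a NULL
    dequeue [d0], induction on the level shows that all bad enqueues come after [d0] in [s], whereas
    [Before c d0] lies before it. *)
Lemma fifo_matching_witness s M :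
    s =i completed c ->
    {in completed c &, forall e e', precedes c e e' -> index e s < index e' s} ->
  fifo_matching s M -> linearization_witness c M.
Proof.
move=> s_c s_prec [MA MB MC MD ME].
have lt_irr e e' : e \in s -> e' \in s -> index e s < index e' s ->
    ~~ precedes c e' e.
  rewrite !s_c => es e's lt_ee'; apply/negP => /s_prec /=.
  by move=> /(_ e's es); rewrite ltnNge (ltnW lt_ee').
have DeqP d : d \in DeqEv c -> d \in s /\ is_deq d.
  by rewrite s_c => /andP[].
have EnqP e : e \in EnqEv c -> e \in s /\ is_enq e.
  by rewrite s_c => /andP[].
have DeqI d : d \in s -> is_deq d -> d \in DeqEv c.
  by rewrite s_c => dc dd; apply/andP.
have EnqI e : e \in s -> is_enq e -> e \in EnqEv c.
  by rewrite s_c => ec ee; apply/andP.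
split; first split; first split.
- by move=> d /DeqP[ds dd] e /(MA _ _ ds dd)[*]; apply: EnqI.
- by move=> d /DeqP[ds dd] e /(MA _ _ ds dd)[].
- by move=> d /DeqP[ds dd]; apply: MB.
- by move=> d d' /DeqP[ds dd] /DeqP[d's d'd]; apply: MC.
- by move=> d /DeqP[ds dd] e /(MA _ _ ds dd)[es _ _ /lt_irr]; apply.
- move=> d' e' e /DeqP[d's d'd] /EnqP[es ee] Md' e_e'.
  have [e's _ _ _] := MA _ _ d's d'd Md'.
  have lt_ee' : index e s < index e' s by apply: s_prec => //; rewrite -s_c.
  have [d [ds dd Md lt_dd']] := MD _ _ _ d's d'd Md' es ee lt_ee'.
  by exists d; split; [apply: DeqI | | apply: lt_irr].
move=> d0 /DeqP[ds dd] d0_null e [[i Bi] /andP[ec e_d0]].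
have lt_ed0 : index e s < index d0 s by apply: s_prec => //; rewrite -s_c.
suff lt_d0e : index d0 s < index e s by rewrite ltnNge (ltnW lt_ed0) in lt_d0e.
(* An enqueue before [d0] would have a server before [d0] by the last clause. For an unmatched [e1]
   the assumption holds vacuously. *)
have served e1 : e1 \in s -> is_enq e1 ->
    (forall d, d \in DeqEv c -> M d = Some e1 -> index d0 s < index d s) ->
    index d0 s < index e1 s.
  move=> e1s e1e after; rewrite ltnNge leq_eqVlt; apply/negP => /predU1P[|lt_e1].
    by move=> /(index_inj e) eq_e1; rewrite /is_deq -eq_e1 ?e1e in dd.
  have [d' [d's d'd Md' lt_d']] := ME _ _ ds dd d0_null e1s e1e lt_e1.
  have := after _ (DeqI _ d's d'd) Md'.
  by rewrite ltnNge (ltnW lt_d').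
elim: i e Bi {ec e_d0 lt_ed0} => [|i IHi] e /= [/EnqP[es ee]].
  case=> [d0_e|after]; first by apply: s_prec; rewrite -?s_c.
  apply: served => // d dD Md; apply: s_prec; rewrite -?s_c //.
    by case: (DeqP _ dD).
  exact: after.
case=> ej [Bj ej_e]; have lt_ej := IHi _ Bj.
have ejs : ej \in s by case: i {IHi} Bj => [|i] /= [/EnqP[]].
case: ej_e => [ej_e|[d [/DeqP[d's d'd] Md ej_d]]].
  by apply: ltn_trans lt_ej _; apply: s_prec; rewrite -?s_c.
apply: served => // d' /DeqP[d1s d1d] Md'.
have -> : d' = d by apply: MC; rewrite ?Md ?Md'.
by apply: ltn_trans lt_ej _; apply: s_prec; rewrite -?s_c.
Qed.

(** * From a witness to a linearization *)

Section Witness.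

Variable M : event U -> option (event U).
Hypothesis M_witness : linearization_witness c M.

Variable evs : seq (event U).
Hypothesis evs_c : evs =i completed c.

Let evs_inv e : e \in evs -> I e < R e.
Proof. by rewrite evs_c => /completed_index. Qed.

Let R_size e : e \in evs -> R e < size c.
Proof. by rewrite evs_c => /andP[_ re]; rewrite index_mem. Qed.

Let I_size e : e \in evs -> I e < size c.
Proof. by move=> es; apply: ltn_trans (evs_inv es) (R_size es). Qed.

Let precedesE e e' : e \in evs -> e' \in evs -> precedes c e e' = (R e < I e').
Proof. by rewrite !evs_c; apply: precedes_index. Qed.

Let DeqI d : d \in evs -> is_deq d -> d \in DeqEv c.
Proof. by rewrite evs_c => dc dd; apply/andP. Qed.

Let EnqI e : e \in evs -> is_enq e -> e \in EnqEv c.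
Proof. by rewrite evs_c => ec ee; apply/andP. Qed.

Let DeqP d : d \in DeqEv c -> d \in evs /\ is_deq d.
Proof. by rewrite evs_c => /andP[]. Qed.

Let EnqP e : e \in EnqEv c -> e \in evs /\ is_enq e.
Proof. by rewrite evs_c => /andP[]. Qed.

Let M_enq d e : d \in evs -> is_deq d -> M d = Some e ->
  [/\ e \in evs, is_enq e, Val d = Val e & I e <= R d].
Proof.
case: M_witness => -[[Mm Mv _ _] Mo _] _ ds dd Md.
have dD := DeqI ds dd; have [es ee] := EnqP (Mm _ dD _ Md).
split=> //; first exact: Mv.
by have := Mo _ dD _ Md; rewrite precedesE // -leqNgt.
Qed.

Let M_null d : d \in evs -> is_deq d -> M d = None <-> Val d = None.
Proof. by case: M_witness => -[[_ _ Mn _] _ _] _ ds dd; apply/Mn/DeqI. Qed.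

Let M_inj d d' e : d \in evs -> d' \in evs -> is_deq d -> is_deq d' ->
  M d = Some e -> M d' = Some e -> d = d'.
Proof.
case: M_witness => -[[_ _ _ Mi] _ _] _ ds d's dd d'd Md Md'.
by apply: Mi; rewrite ?Md ?Md' //; apply: DeqI.
Qed.

(** The partial inverse of [M], found by search in [evs]; by [M_inj] the list has at most one
    element. *)
Definition server e : option (event U) :=
  ohead [seq d <- evs | is_deq d & M d == Some e].

Let serverP e d : server e = Some d -> [/\ d \in evs, is_deq d & M d = Some e].
Proof.
rewrite /server => H; have : d \in [seq d <- evs | is_deq d & M d == Some e].
  by move: H; case: [seq _ <- _ | _] => //= a l [->]; rewrite mem_head.
by rewrite mem_filter => /andP[/andP[dd /eqP Md] ds].
Qed.

Let serverE e d : d \in evs -> is_deq d -> M d = Some e -> server e = Some d.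
Proof.
move=> ds dd Md; case sd: (server e) => [d'|].
  by have [d's d'd Md'] := serverP sd; rewrite (M_inj ds d's dd d'd Md Md').
have : d \in [seq d <- evs | is_deq d & M d == Some e].
  by rewrite mem_filter dd Md eqxx.
by move: sd; rewrite /server; case: [seq _ <- _ | _].
Qed.

(* An unmatched enqueue is served by a virtual dequeue at time [size c],
   after all actions of [c]. *)
Definition serve_inv e := if server e is Some d then I d else size c.
Definition serve_res e := if server e is Some d then R d else size c.

Let serve_le e : serve_inv e <= serve_res e.
Proof.
rewrite /serve_inv /serve_res; case sd: (server e) => [d|//].
by have [ds _ _] := serverP sd; rewrite ltnW ?evs_inv.
Qed.

Let inv_serve_res e : e \in evs -> I e <= serve_res e.
Proof.
move=> es; rewrite /serve_res; case sd: (server e) => [d|]; last exact/ltnW/I_size.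
by have [ds dd Md] := serverP sd; case: (M_enq ds dd Md).
Qed.

(* A point at which a NULL dequeue can take effect: whatever has to be
   enqueued or dequeued after [t] can still be enqueued after [t]. *)
Definition cut_point (t : nat) : Prop :=
  {in evs, forall e, is_enq e -> t < maxn (I e) (serve_inv e) -> t <= R e}.

(** Start at [R d]. If an enqueue [e] violates the cut condition at the current time, then [e] is
    bad, and the time moves down to [R e]. This descent stops, and it never passes below [I d],
    because a bad enqueue does not precede [d]. *)
Lemma null_cut_point d : d \in evs -> is_deq d -> Val d = None ->
  exists t, I d <= t <= R d /\ cut_point t.
Proof.
move=> ds dd d0; have dD := DeqI ds dd.
pose start t := t = R d \/ exists2 e, Bad c M d e & R e = t.
have Bad_enq e : Bad c M d e -> e \in evs /\ is_enq e.
  by case=> -[|i] [/EnqP[]].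
have start_bad t e : start t -> e \in evs -> is_enq e ->
    t < maxn (I e) (serve_inv e) -> Bad c M d e.
  move=> st es ee lt_t; have eE := EnqI es ee.
  (* An unmatched enqueue is bad at level 0, vacuously. *)
  case sd: (server e) => [d'|]; last first.
    exists 0; split=> //; right=> d' /DeqP[d's d'd] Md'.
    by rewrite (serverE d's d'd Md') in sd.
  have [d's d'd Md'] := serverP sd.
  move: lt_t; rewrite /serve_inv sd leq_max => lt_t.
  case: st => [eq_t|[f [i Bf] eq_t]]; subst t.
    exists 0; split=> //; case/orP: lt_t => lt_t.
      by left; rewrite precedesE.
    right=> d1 /DeqP[d1s d1d] Md1; rewrite precedesE //.
    by rewrite (M_inj d1s d's d1d d'd Md1 Md').
  have [fs _] : f \in evs /\ is_enq f by apply: Bad_enq; exists i.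
  exists i.+1; split=> //; exists f; split=> //; case/orP: lt_t => lt_t.
    by left; rewrite precedesE.
  by right; exists d'; rewrite precedesE //; split=> //; apply: DeqI.
have Bad_late e : Bad c M d e -> I d <= R e.
  move=> Be; have [es _] := Bad_enq _ Be.
  case: M_witness => _ /(_ _ dD d0 e) not_before.
  rewrite leqNgt -precedesE //; apply/negP => e_d; apply: not_before.
  by split=> //; rewrite evs_c in es; apply/andP.
have step t : start t -> t <= R d ->
    exists t', I d <= t' <= R d /\ cut_point t'.
  elim/ltn_ind: t => t IHt st le_t.
  have [|ok] := boolP (has (fun e => [&& is_enq e,
      t < maxn (I e) (serve_inv e) & R e < t]) evs).
    case/hasP => e es /and3P[ee lt_te lt_et].
    apply: (IHt (R e)) => //; last exact: ltnW (leq_trans lt_et le_t).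
    by right; exists e => //; apply: start_bad st es ee lt_te.
  exists t; split.
    rewrite le_t andbT; case: st => [->|[e Be <-]]; last exact: Bad_late.
    by rewrite ltnW ?evs_inv.
  move=> e es ee lt_te; rewrite leqNgt.
  by have := hasPn ok e es; rewrite ee lt_te.
by apply: (step (R d)) => //; left.
Qed.

Definition is_null d := is_deq d && (Val d == None).

Lemma witness_fifo_order : uniq evs ->
  exists s, [/\ perm_eq s evs, fifo_matching s M
    & {in evs &, forall e e', precedes c e e' -> index e s < index e' s}].
Proof.
move=> evs_uniq.
have [tau tauP] : exists tau, {in [seq d <- evs | is_null d],
    forall d, I d <= tau d <= R d /\ cut_point (tau d)}.
  apply: (@choice_seq _ _ (fun d t => I d <= t <= R d /\ cut_point t)) => d.
  by rewrite mem_filter => /andP[/andP[dd /eqP d0] ds]; apply: null_cut_point.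
have {}tauP d : d \in evs -> is_null d -> I d <= tau d <= R d /\ cut_point (tau d).
  by move=> ds dn; apply: tauP; rewrite mem_filter dn.
(* An enqueue represents its whole pair, so dequeues that return a value are not nodes. *)
pose is_node e := is_enq e || is_null e.
pose nodes := [seq e <- evs | is_node e].
pose i1 e := if is_enq e then I e else tau e.
pose r1 e := if is_enq e then minn (R e) (serve_res e) else tau e.
pose i2 e := if is_enq e then maxn (I e) (serve_inv e) else tau e.
pose r2 e := if is_enq e then serve_res e else tau e.
have nodesP e : e \in nodes -> e \in evs /\ (~~ is_enq e -> is_null e).
  by rewrite mem_filter => /andP[/orP[->|en] ->].
have [||||rank [t1 [t2 [[rank_inj rank_lt] t1P t2P t12 t_mono]]]] :=
    @interval_orders_points _ i1 r1 i2 r2 nodes.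
- move=> e /nodesP[es _]; rewrite /i1 /r1; case: ifP => // ee.
  by rewrite leq_min inv_serve_res // ltnW ?evs_inv.
- move=> e /nodesP[es _]; rewrite /i2 /r2; case: ifP => // ee.
  by rewrite geq_max serve_le inv_serve_res.
- by move=> e _; rewrite /i1 /i2; case: ifP => // _; rewrite leq_maxl.
- move=> x y /nodesP[xs xn] /nodesP[ys yn]; rewrite /i1 /r1 /i2 /r2.
  have sx := inv_serve_res xs; have sy := inv_serve_res ys.
  have slx := serve_le x; have sly := serve_le y.
  case: ifP => xe; case: ifP => ye; last by lia.
  + have Ix := evs_inv xs; have Iy := evs_inv ys.
    move=> lt1 lt2.
    (* If [serve_res x < I y], then [I y <= serve_res y < i2 x <= serve_res x], which is absurd; so
       [R x < I y]. Then [I x < serve_res y], and [i2 x] must be [serve_inv x]. This is the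
       situation that orderedness forbids. *)
    have {lt1 lt2}[lt1 lt2] : R x < I y /\ serve_res y < serve_inv x by lia.
    move: lt2; rewrite /serve_res; case sd: (server y) => [d'|]; last first.
      rewrite /serve_inv; case sx': (server x) => [d|]; last by lia.
      by have [ds _ _] := serverP sx'; have := I_size ds; lia.
    have [d's d'd Md'] := serverP sd.
    case: M_witness => -[_ _ Mord] _.
    have [|d [/DeqP[ds dd] Md]] := Mord _ _ _ (DeqI d's d'd) (EnqI xs xe) Md'.
      by rewrite precedesE.
    by rewrite /serve_inv (serverE ds dd Md) precedesE // => /negbTE->.
  (* The cut property gives [tau y <= R x], so [r1 x] is [serve_res x], and [serve_res x < tau y <
     i2 x <= serve_res x] is absurd. *)
  + have [_ cut] := tauP _ ys (yn (negbT ye)).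
    by move=> lt1 lt2; have := cut _ xs xe lt2; lia.
  + by lia.
(* A value dequeue is placed through its enqueue, at the point [t2]; [late] puts it after that
   enqueue when the points agree. Within [evs] the default of [odflt] never occurs, by [M_null]. *)
pose node e := if is_enq e || (Val e == None) then e else odflt e (M e).
pose late e := is_deq e && (Val e != None).
pose t e := if late e then t2 (node e) else t1 (node e).
(* A NULL dequeue sits between the nodes that precede it, whose dequeue points
   are at most [tau], and those that follow it, whose enqueue points are at
   least [tau]. *)
pose key e := lex_key (size nodes) (t e) (rank (node e)) (late e).
have key_time x y : node x \in nodes -> t x < t y -> key x < key y.
  by move=> /rank_lt; apply: lex_key_lt1.
have key_rank x y : t x <= t y -> rank (node x) < rank (node y) -> key x < key y.
  exact: lex_key_lt2.
have enq_node e : e \in evs -> is_enq e ->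
    [/\ e \in nodes, node e = e, late e = false & t e = t1 e].
  move=> es ee; rewrite /t /late /node mem_filter /is_node es ee.
  by rewrite /is_deq ee.
have null_node d : d \in evs -> is_null d ->
    [/\ d \in nodes, node d = d, late d = false, t d = t1 d & t1 d = tau d].
  move=> ds dn; have /andP[dd /eqP d0] := dn.
  have dN : d \in nodes by rewrite mem_filter /is_node dn orbT.
  rewrite /t /late /node d0 eqxx orbT andbF; split=> //.
  have := t1P _ dN; rewrite /i1 /r1 (negbTE dd).
  by rewrite -eqn_leq eq_sym => /eqP.
have deq_node d e : d \in evs -> is_deq d -> M d = Some e ->
    [/\ e \in nodes, node d = e, late d & t d = t2 e].
  move=> ds dd Md; have [es ee Vd _] := M_enq ds dd Md.
  have Vd0 : Val d != None.
    by apply/eqP => /(M_null ds dd); rewrite Md.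
  rewrite /t /late /node dd (negbTE dd) (negbTE Vd0) Md /=.
  by rewrite mem_filter /is_node ee es.
have deq_time d e : d \in evs -> is_deq d -> M d = Some e -> I d <= t2 e <= R d.
  move=> ds dd Md; have [eN _ _ _] := deq_node _ _ ds dd Md.
  have [_ ee _ _] := M_enq ds dd Md.
  have := t2P _ eN; rewrite /i2 /r2 ee /serve_inv /serve_res (serverE ds dd Md).
  by rewrite geq_max => /andP[/andP[_ ->] ->].
have timeP e : e \in evs -> node e \in nodes /\ I e <= t e <= R e.
  move=> es; have [ee|dd] := boolP (is_enq e).
    have [eN -> _ ->] := enq_node _ es ee; split=> //.
    have := t1P _ eN; rewrite /i1 /r1 ee leq_min.
    by case/and3P=> -> ->.
  case Me: (M e) => [f|].
    by have [fN -> _ ->] := deq_node _ _ es dd Me; split=> //; apply: deq_time.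
  have en : is_null e by rewrite /is_null /is_deq dd; apply/eqP/(M_null es dd).
  have [eN -> _ -> ->] := null_node _ es en; split=> //.
  by case: (tauP _ es en).
pose s := sort (fun x y => key x <= key y) evs.
have mem_s : s =i evs by apply: mem_sort.
have key_lt : {in evs &, forall x y, key x < key y -> index x s < index y s}.
  exact: index_sort_key_lt.
(* Positions in [s] come from keys that use [t1] on nodes; going back to ranks makes the
   monotonicity of [t2] available too. *)
have rank_of x y : x \in evs -> y \in evs -> node x = x -> node y = y ->
    x \in nodes -> y \in nodes -> late x = false -> late y = false ->
    index x s < index y s -> rank x < rank y.
  move=> xs ys nx ny xN yN lx ly lt_xy; rewrite ltnNge leq_eqVlt.
  apply/negP => /predU1P[|lt_yx].
    by move=> /(rank_inj _ _ yN xN) eq_xy; rewrite eq_xy ltnn in lt_xy.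
  have [le_t _] := t_mono _ _ yN xN (ltnW lt_yx).
  have /(key_lt _ _ ys xs) : key y < key x.
    by apply: key_rank; rewrite ?nx ?ny // /t lx ly nx ny.
  by rewrite ltnNge (ltnW lt_xy).
exists s; split; first by rewrite perm_sort.
- split.
  + move=> d e; rewrite !mem_s => ds dd Md.
    have [es ee Vd _] := M_enq ds dd Md.
    split=> //; apply: key_lt => //.
    have [eN nd ld td] := deq_node _ _ ds dd Md.
    have [_ ne le te] := enq_node _ es ee.
    by rewrite /key nd ne td te ld le lex_key_lt3 // t12.
  + by move=> d; rewrite mem_s; apply: M_null.
  + move=> d d'; rewrite !mem_s => ds d's dd d'd eq_M.
    case Md: (M d) => [e|//] _.
    by apply: (M_inj ds d's dd d'd Md); rewrite -eq_M.
  + move=> d' e' e; rewrite !mem_s => d's d'd Md' es ee lt_ee'.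
    have [e's e'e _ _] := M_enq d's d'd Md'.
    have [eN ne le _] := enq_node _ es ee.
    have [e'N ne' le' _] := enq_node _ e's e'e.
    have lt_r := rank_of _ _ es e's ne ne' eN e'N le le' lt_ee'.
    have [_ le_t2] := t_mono _ _ eN e'N (ltnW lt_r).
    (* If [e] were unserved, [t2 e] would be at least [size c], but
       [t2 e <= t2 e' <= R d' < size c]. *)
    case sd: (server e) => [d|]; last first.
      have := t2P _ eN; rewrite /i2 ee /serve_inv sd geq_max.
      have := deq_time _ _ d's d'd Md'; have := R_size d's; lia.
    have [ds dd Md] := serverP sd; exists d; rewrite mem_s; split=> //.
    apply: key_lt => //.
    have [_ nd _ td] := deq_node _ _ ds dd Md.
    have [_ nd' _ td'] := deq_node _ _ d's d'd Md'.
    by apply: key_rank; rewrite ?td ?td' ?nd ?nd'.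
  + move=> d e; rewrite !mem_s => ds dd d0 es ee lt_ed.
    have dn : is_null d by rewrite /is_null dd d0.
    have [eN ne le _] := enq_node _ es ee.
    have [dN nd ld td t1d] := null_node _ ds dn.
    have lt_r := rank_of _ _ es ds ne nd eN dN le ld lt_ed.
    have [_ le_t2] := t_mono _ _ eN dN (ltnW lt_r).
    have t2d : t2 d <= tau d.
      by have /andP[_] := t2P _ dN; rewrite /r2 (negbTE dd).
    have [/andP[_ tau_R] _] := tauP _ ds dn.
    (* Again [e] must be served, now because [t2 e <= t2 d <= tau d <= R d < size c]. *)
    case sd: (server e) => [d'|]; last first.
      have := t2P _ eN; rewrite /i2 ee /serve_inv sd geq_max.
      have := R_size ds; lia.
    have [d's d'd Md'] := serverP sd; exists d'; rewrite mem_s; split=> //.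
    apply: key_lt => //.
    have [_ nd' _ td'] := deq_node _ _ d's d'd Md'.
    by apply: key_rank; rewrite ?td ?td' ?nd ?nd' // t1d (leq_trans le_t2).
- move=> x y xs ys; rewrite precedesE // => lt_xy; apply: key_lt => //.
  have [xN /andP[_ le_x]] := timeP _ xs; have [_ /andP[le_y _]] := timeP _ ys.
  by apply: key_time => //; apply: leq_ltn_trans le_x (leq_trans lt_xy le_y).
Qed.

End Witness.

End CompleteHistory.

(** * The equivalence for a single history *)

Lemma linearizable_witness c :
  linearizable c <->
  exists chat, Compl c chat /\ exists M, linearization_witness chat M.
Proof.
split.
  case=> s [s_beh [chat [chat_c s_chat s_prec]]] s_legal.
  exists chat; split=> //.
  have [M Mfifo] := legal_fifo_matching (behavior_uniq s_beh) s_legal.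
  by exists M; apply: fifo_matching_witness s_chat s_prec Mfifo.
case=> chat [chat_c [M M_wit]].
have [[chat_hist _] _] := chat_c.
have [evs evs_uniq evs_chat] := completed_enum chat.
have [s [s_perm s_fifo s_prec]] :=
  witness_fifo_order chat_hist M_wit evs_chat evs_uniq.
have s_uniq : uniq s by rewrite (perm_uniq s_perm).
have s_chat : s =i completed chat by move=> e; rewrite (perm_mem s_perm).
exists s; last exact: fifo_matching_legal s_fifo.
split.
  apply: behavior_uniq_id; rewrite map_inj_in_uniq // => e e'.
  by rewrite !s_chat; apply: completed_id_inj.
exists chat; split=> // e e' ec e'c; apply: s_prec; by rewrite evs_chat.
Qed.

End Queue.

Theorem theorem4p7 (U : eqType) (C : seq (action U) -> Prop)
    (C_hist : forall c, C c -> is_history c) :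
  set_linearizable C <->
  (forall c, C c ->
     exists chat, Compl c chat /\ exists M, linearization_witness chat M).
Proof.
by split=> H c Cc; apply/linearizable_witness; apply: H.
Qed.
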